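(* Let $H$ and $G$ be two groups. There exists a bijection between the set of objects of the skeleton of the category $B_1(H,G)$ (equivalently, the set of isomorphism classes of objects of $B_1(H,G)$) and the pointed quotient set $K^2(H,G) := MP(H,G)/\!\approx_1$.
   Context: A matched pair of groups $(H,G,\alpha,\beta)$ consists of groups $H$, $G$, a left action $\alpha:G\times H\to H$, $\alpha(g,h)=g\rhd h$, of the group $G$ on the set $H$, and a right action $\beta:G\times H\to G$, $\beta(g,h)=g\lhd h$, of the group $H$ on the set $G$, such that for all $g,g_1,g_2\in G$, $h,h_1,h_2\in H$: $g\rhd(h_1h_2)=(g\rhd h_1)\bigl((g\lhd h_1)\rhd h_2\bigr)$ and $(g_1g_2)\lhd h=\bigl(g_1\lhd(g_2\rhd h)\bigr)(g_2\lhd h)$. The bicrossed product $H\,{}_{\alpha}\!\bowtie_{\beta} G$ is the group on the set $H\times G$ with unit $(1_H,1_G)$ and multiplication $(h_1,g_1)(h_2,g_2)=\bigl(h_1(g_1\rhd h_2),\,(g_1\lhd h_2)g_2\bigr)$; $i_H(h)=(h,1)$ is the canonical inclusion of $H$. $MP(H,G)$ is the set of all pairs $(\alpha,\beta)$ such that $(H,G,\alpha,\beta)$ is a matched pair. $B_1(H,G)$ is the category with set of objects $MP(H,G)$, in which a morphism $(\alpha',\beta')\to(\alpha,\beta)$ is a group morphism $\psi:H\,{}_{\alpha'}\!\bowtie_{\beta'}G\to H\,{}_{\alpha}\!\bowtie_{\beta}G$ with $\psi\circ i_H=i_H$. Two pairs $(\alpha,\beta),(\alpha',\beta')\in MP(H,G)$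 (with $\alpha,\beta$ written $\rhd,\lhd$ and $\alpha',\beta'$ written $\rhd',\lhd'$) are 1-equivalent, written $(\alpha,\beta)\approx_1(\alpha',\beta')$, if there exist maps $r:G\to H$ and $v:G\to G$ with $v$ bijective such that for all $h\in H$, $g,g_1,g_2\in G$: $(g\rhd'h)\,r(g\lhd'h)=r(g)(v(g)\rhd h)$; $v(g\lhd'h)=v(g)\lhd h$; $r(g_1g_2)=r(g_1)\bigl(v(g_1)\rhd r(g_2)\bigr)$; $v(g_1g_2)=\bigl(v(g_1)\lhd r(g_2)\bigr)v(g_2)$. This is an equivalence relation on $MP(H,G)$. The quotient is pointed by the class of the pair of trivial actions ($g\rhd h=h$, $g\lhd h=g$). *)

(* Defs.v *)
From HB Require Import structures.
From mathcomp Require Import all_boot.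
From mathcomp Require Import boolp classical_sets functions.
Set Implicit Arguments.
Unset Strict Implicit.
Unset Printing Implicit Defensive.

(* [groupType] (mathcomp monoid.v) covers infinite groups; its choice structure is
   harmless, every type having one by [gen_choiceMixin]. *)

Local Open Scope group_scope.
Local Open Scope quotient_scope.

Section MatchedPair.
Variables H G : groupType.

Definition is_left_action (alpha : G -> H -> H) : Prop :=
  (forall h, alpha 1 h = h) /\
  (forall g1 g2 h, alpha (g1 * g2) h = alpha g1 (alpha g2 h)).

Definition is_right_action (beta : G -> H -> G) : Prop :=
  (forall g, beta g 1 = g) /\
  (forall g h1 h2, beta g (h1 * h2) = beta (beta g h1) h2).

Definition is_matched_pair (alpha : G -> H -> H) (beta : G -> H -> G) : Prop :=
  [/\ is_left_action alpha,
      is_right_action beta,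
      (forall g h1 h2,
          alpha g (h1 * h2) = alpha g h1 * alpha (beta g h1) h2) &
      (forall g1 g2 h,
          beta (g1 * g2) h = beta g1 (alpha g2 h) * beta g2 h)].

Record MP := MatchedPair {
  lact : G -> H -> H;
  ract : G -> H -> G;
  matched_pairP : is_matched_pair lact ract
}.

HB.instance Definition _ := gen_eqMixin MP.
HB.instance Definition _ := gen_choiceMixin MP.

Lemma trivial_is_matched_pair : is_matched_pair (fun _ h => h) (fun g _ => g).
Proof. by []. Qed.

Definition trivial_pair : MP := MatchedPair trivial_is_matched_pair.

End MatchedPair.

Notation "g |>[ m ] h" := (lact m g h)
  (at level 35, m at level 200, h at level 34, format "g  |>[ m ]  h").
Notation "g <|[ m ] h" := (ract m g h)
  (at level 35, m at level 200, h at level 34, format "g  <|[ m ]  h").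

Section MatchedPairTheory.
Variables (H G : groupType) (m : MP H G).
Implicit Types (g : G) (h : H).

Lemma lact1 h : 1 |>[m] h = h.
Proof. by have [[]] := matched_pairP m. Qed.

Lemma lactM g1 g2 h : (g1 * g2) |>[m] h = g1 |>[m] (g2 |>[m] h).
Proof. by have [[_]] := matched_pairP m. Qed.

Lemma ract1 g : g <|[m] 1 = g.
Proof. by have [_ []] := matched_pairP m. Qed.

Lemma ractM g h1 h2 : g <|[m] (h1 * h2) = (g <|[m] h1) <|[m] h2.
Proof. by have [_ [_]] := matched_pairP m. Qed.

Lemma lact_mul g h1 h2 :
  g |>[m] (h1 * h2) = (g |>[m] h1) * ((g <|[m] h1) |>[m] h2).
Proof. by have [_ _] := matched_pairP m. Qed.

Lemma ract_mul g1 g2 h :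
  (g1 * g2) <|[m] h = (g1 <|[m] (g2 |>[m] h)) * (g2 <|[m] h).
Proof. by have [_ _ _] := matched_pairP m. Qed.

Lemma lactg1 g : g |>[m] 1 = 1.
Proof.
by apply: (mulgI (g |>[m] 1)); rewrite mulg1 -{3}[1]mulg1 lact_mul ract1.
Qed.

Lemma ract1h h : 1 <|[m] h = 1.
Proof.
by apply: (mulIg (1 <|[m] h)); rewrite mul1g -{3}[1]mulg1 ract_mul lact1.
Qed.

End MatchedPairTheory.

Definition bicrossed (H G : groupType) (m : MP H G) : Type := (H * G)%type.

Section Bicrossed.
Variables (H G : groupType) (m : MP H G).
Implicit Types p q : bicrossed m.

Definition bicrossed_one : bicrossed m := (1, 1).

Definition bicrossed_mul p q : bicrossed m :=
  (p.1 * (p.2 |>[m] q.1), (p.2 <|[m] q.1) * q.2).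

Definition bicrossed_inv p : bicrossed m :=
  (p.2^-1 |>[m] p.1^-1, p.2^-1 <|[m] p.1^-1).

Lemma bicrossed_mulA : associative bicrossed_mul.
Proof.
case=> [h1 g1] [h2 g2] [h3 g3]; congr pair => /=.
- by rewrite lact_mul lactM mulgA.
- by rewrite ract_mul ractM mulgA.
Qed.

Lemma bicrossed_mul1 : left_id bicrossed_one bicrossed_mul.
Proof.
by case=> h g; rewrite /bicrossed_mul /= lact1 ract1h !mul1g.
Qed.

Lemma bicrossed_mulr1 : right_id bicrossed_one bicrossed_mul.
Proof.
by case=> h g; rewrite /bicrossed_mul /= lactg1 ract1 !mulg1.
Qed.

Lemma bicrossed_mulV :
  left_inverse bicrossed_one bicrossed_inv bicrossed_mul.
Proof.
case=> h g; rewrite /bicrossed_mul /bicrossed_inv /=; congr pair.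
- by rewrite -lact_mul mulVg lactg1.
- by rewrite -ractM mulVg ract1 mulVg.
Qed.

Lemma bicrossed_mulrV :
  right_inverse bicrossed_one bicrossed_inv bicrossed_mul.
Proof.
case=> h g; rewrite /bicrossed_mul /bicrossed_inv /=; congr pair.
- by rewrite -lactM mulgV lact1 mulgV.
- by rewrite -ract_mul mulgV ract1h.
Qed.

HB.instance Definition _ := Choice.copy (bicrossed m) (H * G)%type.
HB.instance Definition _ := isGroup.Build (bicrossed m)
  bicrossed_mulA bicrossed_mul1 bicrossed_mulr1 bicrossed_mulV bicrossed_mulrV.

Definition i_H (h : H) : bicrossed m := (h, 1).

End Bicrossed.

Record category := Category {
  obj :> Type;
  hom : obj -> obj -> Type;
  idm : forall x, hom x x;
  comp : forall x y z, hom y z -> hom x y -> hom x z;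
  comp_idl : forall x y (f : hom x y), comp (idm y) f = f;
  comp_idr : forall x y (f : hom x y), comp f (idm x) = f;
  compA : forall x y z t (f : hom z t) (g : hom y z) (k : hom x y),
    comp f (comp g k) = comp (comp f g) k
}.

Section Isomorphism.
Variable C : category.

Definition isomorphic (x y : C) : Prop :=
  exists (f : hom x y) (g : hom y x), comp g f = idm x /\ comp f g = idm y.

(* [S] is the set of objects of a skeleton of [C], i.e. of a full subcategory
   in which every object of [C] has exactly one isomorphic copy. *)
Definition is_skeleton_obj (S : set C) : Prop :=
  (forall x, exists2 y, S y & isomorphic x y) /\
  (forall x y, S x -> S y -> isomorphic x y -> x = y).

Definition isomorphicb (x y : {classic C}) : bool := `[< isomorphic x y >].

Lemma isomorphicb_refl : reflexive isomorphicb.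
Proof.
by move=> x; apply/asboolP; exists (idm x), (idm x); rewrite comp_idl.
Qed.

Lemma isomorphicb_sym : symmetric isomorphicb.
Proof.
by move=> x y; apply/asboolP/asboolP => -[f [g [gf fg]]]; exists g, f.
Qed.

Lemma isomorphicb_trans : transitive isomorphicb.
Proof.
move=> y x z /asboolP[f [g [gf fg]]] /asboolP[f' [g' [gf' fg']]].
apply/asboolP; exists (comp f' f), (comp g g'); split.
- by rewrite compA -(compA g) gf' comp_idr gf.
- by rewrite compA -(compA f') fg comp_idr fg'.
Qed.

Canonical isomorphicb_equiv :=
  EquivRel isomorphicb isomorphicb_refl isomorphicb_sym isomorphicb_trans.

Definition iso_class : Type := {eq_quot isomorphicb}.
HB.instance Definition _ := Choice.on iso_class.
HB.instance Definition _ := EqQuotient.on iso_class.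

End Isomorphism.

Section B1.
Variables H G : groupType.

(* [UMagmaMorphism.type] between two groups is the type of group morphisms. *)
Record B1_hom (m' m : MP H G) := B1Hom {
  B1_fun :> UMagmaMorphism.type (bicrossed m') (bicrossed m);
  B1_fun_i_H : B1_fun \o @i_H H G m' = @i_H H G m
}.

Lemma B1_hom_eq (m' m : MP H G) (f g : B1_hom m' m) : f =1 g -> f = g.
Proof.
case: f g => [[f [[fM] [f1]]] fi] [[g [[gM] [g1]]] gi] /= /funext fg.
by subst g; rewrite (Prop_irrelevance fM gM) (Prop_irrelevance f1 g1)
  in fi gi *; rewrite (Prop_irrelevance fi gi).
Qed.

Definition B1_id (m : MP H G) : B1_hom m m :=
  @B1Hom m m (idfun : UMagmaMorphism.type _ _) erefl.

Lemma B1_comp_subproof (m1 m2 m3 : MP H G)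
  (f : B1_hom m2 m3) (g : B1_hom m1 m2) : (f \o g) \o @i_H H G m1 = @i_H H G m3.
Proof. by rewrite -(B1_fun_i_H f) -(B1_fun_i_H g). Qed.

Definition B1_comp (m1 m2 m3 : MP H G)
    (f : B1_hom m2 m3) (g : B1_hom m1 m2) : B1_hom m1 m3 :=
  @B1Hom m1 m3 (f \o g : UMagmaMorphism.type _ _) (B1_comp_subproof f g).

Definition B1 : category.
Proof.
refine (@Category (MP H G) B1_hom B1_id B1_comp _ _ _).
- by move=> *; apply: B1_hom_eq.
- by move=> *; apply: B1_hom_eq.
- by move=> *; apply: B1_hom_eq.
Defined.

End B1.

Section OneEquivalence.
Variables H G : groupType.

(* [m] is the pair of the unprimed actions, [m'] that of the primed ones. *)
Definition equiv1 (m m' : MP H G) : Prop :=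
  exists (r : G -> H) (v : G -> G), bijective v /\
  [/\ (forall g h,
          (g |>[m'] h) * r (g <|[m'] h) = r g * (v g |>[m] h)),
      (forall g h, v (g <|[m'] h) = v g <|[m] h),
      (forall g1 g2, r (g1 * g2) = r g1 * (v g1 |>[m] r g2)) &
      (forall g1 g2, v (g1 * g2) = (v g1 <|[m] r g2) * v g2)].

Definition equiv1b (m m' : MP H G) : bool := `[< equiv1 m m' >].

Lemma equiv1b_refl : reflexive equiv1b.
Proof.
move=> m; apply/asboolP; exists (fun=> 1), id; split; first by exists id.
by split=> * //; rewrite ?lactg1 ?ract1 ?mulg1 ?mul1g.
Qed.

Lemma equiv1_sym (m m' : MP H G) : equiv1 m m' -> equiv1 m' m.
Proof.
move=> [r [v [[w vK wK] [e1 e2 e3 e4]]]].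
exists (fun g => (r (w g))^-1), w; split; first by exists v.
have e2' g h : w (g <|[m] h) = w g <|[m'] h.
  by rewrite -{1}[g]wK -e2 vK.
have wM g1 g2 : w (g1 * g2) = (w g1 <|[m'] (r (w g2))^-1) * w g2.
  apply: (can_inj vK); rewrite e4 e2 !wK -ractM mulVg ract1 //.
split=> // [g h|g1 g2].
- apply: (mulgI (r (w g))); apply: (mulIg (r (w g <|[m'] h))).
  by rewrite e2' -!mulgA mulVg mulg1 mulVKg e1 wK.
- apply: invg_inj; rewrite invgM !invgK wM e3.
  set s := r (w g2); have := e1 (w g1) s^-1.
  rewrite wK => e1s; rewrite e2 wK.
  have -> : r (w g1 <|[m'] s^-1)
      = (w g1 |>[m'] s^-1)^-1 * (r (w g1) * (g1 |>[m] s^-1)).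
    by rewrite -e1s mulKg.
  by rewrite -!mulgA -lact_mul mulVg lactg1 mulg1.
Qed.

Lemma equiv1b_sym : symmetric equiv1b.
Proof. by move=> m m'; apply/asboolP/asboolP; exact: equiv1_sym. Qed.

Lemma equiv1b_trans : transitive equiv1b.
Proof.
move=> m' m m'' /asboolP[r2 [v2 [v2_bij [b1 b2 b3 b4]]]].
move=> /asboolP[r1 [v1 [v1_bij [a1 a2 a3 a4]]]]; apply/asboolP.
exists (fun g => r1 g * r2 (v1 g)), (v2 \o v1).
split; first exact: bij_comp.
split=> [g h|g h|g1 g2|g1 g2] /=.
- by rewrite mulgA a1 a2 -mulgA b1 mulgA.
- by rewrite a2 b2.
- rewrite a3 a4 b3 b2 lact_mul !mulgA; congr (_ * _).
  by rewrite -mulgA b1 !mulgA.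
- by rewrite a4 b4 b2 ractM.
Qed.

Canonical equiv1b_equiv :=
  EquivRel equiv1b equiv1b_refl equiv1b_sym equiv1b_trans.

Definition K2 : Type := {eq_quot equiv1b}.
HB.instance Definition _ := Choice.on K2.
HB.instance Definition _ := EqQuotient.on K2.
HB.instance Definition _ := isPointed.Build K2 (\pi_K2 (trivial_pair H G)).

End OneEquivalence.

(* Main.v *)
Require Import Defs.
From HB Require Import structures.
From mathcomp Require Import all_boot.
From mathcomp Require Import boolp classical_sets functions.

(** A morphism [psi] of bicrossed products that is the identity on [H] is
    determined by its values on [G]: writing [psi (1, g) = (r g, v g)], the
    factorisation [(h, g) = (h, 1) (1, g)] gives [psi (h, g) = (h * r g, v g)].
    Evaluating multiplicativity of [psi] on the products [(1, g) (h, 1)] and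
    [(1, g1) (1, g2)] yields exactly the four identities in the definition of
    1-equivalence, and conversely these identities suffice for
    [(h, g) |-> (h * r g, v g)] to be multiplicative.  Since that map is
    bijective exactly when [v] is, two matched pairs are isomorphic in
    [B1 H G] if and only if they are 1-equivalent ([isomorphic_B1E]).  Hence
    the two quotients of [MP H G] coincide, and a set of representatives of
    the isomorphism classes is in bijection with [K2 H G]. *)

Set Implicit Arguments.
Unset Strict Implicit.
Unset Printing Implicit Defensive.

Local Open Scope group_scope.
Local Open Scope quotient_scope.

Lemma bicrossed_mulE (H G : groupType) (m : MP H G) (p q : bicrossed m) :
  p * q = (p.1 * (p.2 |>[m] q.1), (p.2 <|[m] q.1) * q.2).
Proof. by []. Qed.

Section Components.
Variables (H G : groupType) (m' m : MP H G) (psi : B1_hom m' m).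

(** The [H]-component of the restriction of [psi] to [G]. *)
Definition B1_r (g : G) : H := (psi (1, g)).1.
(** The [G]-component of the restriction of [psi] to [G]. *)
Definition B1_v (g : G) : G := (psi (1, g)).2.

Lemma B1_homE h g : psi (h, g) = (h * B1_r g, B1_v g).
Proof.
have psiH : psi (h, 1) = (h, 1) := congr1 (fun f => f h) (B1_fun_i_H psi).
have -> : ((h, g) : bicrossed m') = ((h, 1) : bicrossed m') * (1, g).
  by rewrite bicrossed_mulE /= lact1 ract1h mulg1 mul1g.
by rewrite gmulfM psiH bicrossed_mulE /= lact1 ract1h mul1g.
Qed.

(** Multiplicativity of [psi] on [(1, g1) (h, g2)]; the cases [g2 = 1] and
    [h = 1] give the four identities of 1-equivalence. *)
Lemma B1_hom_prod g1 h g2 :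
  (g1 |>[m'] h) * B1_r ((g1 <|[m'] h) * g2)
    = B1_r g1 * (B1_v g1 |>[m] (h * B1_r g2)) /\
  B1_v ((g1 <|[m'] h) * g2) = (B1_v g1 <|[m] (h * B1_r g2)) * B1_v g2.
Proof.
have := @gmulfM _ _ psi (1, g1) (h, g2).
by rewrite !bicrossed_mulE /= !B1_homE /= !mul1g => -[].
Qed.

Lemma B1_r1 : B1_r 1 = 1.
Proof. by have : psi (1, 1) = 1 := @gmulf1 _ _ psi; rewrite B1_homE mul1g => -[]. Qed.

Lemma B1_v1 : B1_v 1 = 1.
Proof. by have : psi (1, 1) = 1 := @gmulf1 _ _ psi; rewrite B1_homE mul1g => -[]. Qed.

End Components.

Lemma B1_hom_of_equiv1 (H G : groupType) (m' m : MP H G)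
    (r : G -> H) (v : G -> G) :
    (forall g h, (g |>[m'] h) * r (g <|[m'] h) = r g * (v g |>[m] h)) ->
    (forall g h, v (g <|[m'] h) = v g <|[m] h) ->
    (forall g1 g2, r (g1 * g2) = r g1 * (v g1 |>[m] r g2)) ->
    (forall g1 g2, v (g1 * g2) = (v g1 <|[m] r g2) * v g2) ->
  exists psi : B1_hom m' m, forall h g, psi (h, g) = (h * r g, v g).
Proof.
move=> lact_r v_ract rM vM.
pose f (p : bicrossed m') : bicrossed m := (p.1 * r p.2, v p.2).
have fM : {morph f : p q / p * q}.
  case=> [h1 g1] [h2 g2]; rewrite !bicrossed_mulE /f /=; congr pair.
  - rewrite rM v_ract lact_mul !mulgA; congr (_ * _).
    by rewrite -2!mulgA lact_r !mulgA.
  - by rewrite vM v_ract ractM.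
have f1 : f 1 = 1 by apply: (mulgI (f 1)); rewrite -fM !mulg1.
pose fU := isUMagmaMorphism.Build (bicrossed m') (bicrossed m) f (f1, fM).
pose F : UMagmaMorphism.type (bicrossed m') (bicrossed m) :=
  HB.pack f fU.
have Fi : F \o @i_H H G m' = @i_H H G m.
  have [r1 v1] : (1 * r 1, v 1) = (1, 1) := f1.
  by apply/funext => h; rewrite /= /f /i_H /= -[r 1]mul1g r1 v1 mulg1.
by exists (B1Hom Fi).
Qed.

(** The inverse of a bijective morphism is a morphism, so the isomorphisms of
    [B1 H G] are its bijective morphisms. *)
Lemma B1_bij_isomorphic (H G : groupType) (m' m : MP H G)
    (psi : B1_hom m' m) :
  bijective psi -> @isomorphic (B1 H G) m' m.
Proof.
case=> f psiK fK.
have fM := can2_gmulfM psiK fK; have f1 := can2_gmulf1 psiK fK.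
pose fU := isUMagmaMorphism.Build (bicrossed m) (bicrossed m') f (f1, fM).
pose F : UMagmaMorphism.type (bicrossed m) (bicrossed m') :=
  HB.pack f fU.
have Fi : F \o @i_H H G m = @i_H H G m'.
  by apply/funext => h; rewrite -(B1_fun_i_H psi) /= psiK.
by exists psi, (B1Hom Fi); split; apply: B1_hom_eq.
Qed.

(** The roles of the two pairs are swapped: [equiv1] takes the codomain of the
    morphism first. *)
Lemma isomorphic_B1E (H G : groupType) (m' m : MP H G) :
  @isomorphic (B1 H G) m' m <-> equiv1 m m'.
Proof.
split=> [[psi [phi [psiK phiK]]]|[r [v [[w vK wK] [lact_r v_ract rM vM]]]]].
- exists (B1_r psi), (B1_v psi); split; last first.
    split=> [g h|g h|g1 g2|g1 g2].
    + by have [] := B1_hom_prod psi g h 1; rewrite B1_r1 !mulg1.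
    + by have [_] := B1_hom_prod psi g h 1; rewrite B1_r1 B1_v1 !mulg1.
    + by have [] := B1_hom_prod psi g1 1 g2; rewrite lactg1 ract1 !mul1g.
    + by have [_] := B1_hom_prod psi g1 1 g2; rewrite ract1 !mul1g.
  have psiKE p : phi (psi p) = p.
    exact: (congr1 (fun k : B1_hom m' m' => k p) psiK).
  have phiKE p : psi (phi p) = p.
    exact: (congr1 (fun k : B1_hom m m => k p) phiK).
  exists (B1_v phi) => g.
  + by have := psiKE (1, g); rewrite !B1_homE => -[].
  + by have := phiKE (1, g); rewrite !B1_homE => -[].
- have [psi psiE] := B1_hom_of_equiv1 lact_r v_ract rM vM.
  apply: (B1_bij_isomorphic (psi := psi)).
  exists (fun p => (p.1 * (r (w p.2))^-1, w p.2)) => -[h g].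
  + by rewrite psiE /= vK mulgK.
  + by rewrite psiE /= wK mulgVK.
Qed.

Lemma pi_K2E (H G : groupType) (m' m : MP H G) :
  \pi_(K2 H G) m' = \pi_(K2 H G) m <-> @isomorphic (B1 H G) m' m.
Proof.
rewrite isomorphic_B1E; split=> [/eqmodP/asboolP|e].
  exact: equiv1_sym.
by apply/eqmodP/asboolP/equiv1_sym.
Qed.

Lemma pi_iso_classE (C : category) (x y : C) :
  \pi_(iso_class C) x = \pi_(iso_class C) y <-> isomorphic x y.
Proof.
by split=> [/eqmodP/asboolP|e] //; apply/eqmodP/asboolP.
Qed.

Theorem theorem3p3 (H G : groupType) :
  (exists f : iso_class (B1 H G) -> K2 H G, bijective f) /\
  (forall S : set (B1 H G), is_skeleton_obj S ->
     exists f : B1 H G -> K2 H G, set_bij S [set: K2 H G]%classic f).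
Proof.
split=> [|S [S_total S_uniq]].
- exists (fun c => \pi_(K2 H G) (repr c)).
  exists (fun k => \pi_(iso_class (B1 H G)) (repr k : B1 H G)) => c.
  + rewrite -[RHS]reprK; apply/pi_iso_classE/pi_K2E; exact: reprK.
  + rewrite -[RHS]reprK; apply/pi_K2E/pi_iso_classE; exact: reprK.
- exists (fun m => \pi_(K2 H G) m); split=> [//|m1 m2|k _].
  + by rewrite !inE => S1 S2 /pi_K2E; exact: S_uniq.
  + have [m Sm iso_m] := S_total (repr k).
    by exists m => //; rewrite -[RHS]reprK; apply/esym/pi_K2E.
Qed.
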